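(* Let $n \ge 1$ and let $\mathcal{A}$ be a non-degenerate deformation of the type $A_{n-1}$ Coxeter arrangement in $\mathbb{R}^n$, i.e. \[\mathcal{A} = \{x_i-x_j = a_{ij}^{(1)},\ldots,a_{ij}^{(t_{ij})}\ |\ 1\le i \ne j \le n\},\] where $a_{ij}^{(1)},\ldots,a_{ij}^{(t_{ij})} \in \mathbb{R}$ and $t_{ij} \ge 1$ for all $1 \le i \ne j \le n$. Then \[\chi_{\mathcal{A}}(t) = \sum_{k = 0}^{n} (-1)^{n-k} \cdot r_k(\mathcal{A}) \cdot \binom{t}{k},\] where $r_k(\mathcal{A})$ is the number of regions of $\mathcal{A}$ of level $k$.
   Context: A hyperplane arrangement is a finite set of affine hyperplanes in $\mathbb{R}^n$. Its intersection poset $L(\mathcal{A})$ is the set of all nonempty intersections of hyperplanes of $\mathcal{A}$ (including $\mathbb{R}^n$ itself, the empty intersection), ordered by reverse inclusion. The characteristic polynomial is $\chi_{\mathcal{A}}(t) = \sum_{x \in L(\mathcal{A})} \mu(\hat{0},x)\, t^{\dim x}$, where $\mu$ is the Möbius function of $L(\mathcal{A})$ and $\hat 0 = \mathbb{R}^n$. ''Non-degenerate'' means that for every pair $i \ne j$ there is at least one hyperplane of the form $x_i - x_j = c$ in $\mathcal{A}$ (note $x_i-x_j=c$ and $x_j-x_i=-c$ are the same hyperplane). A region of $\mathcal{A}$ is a connected component of $\mathbb{R}^n \setminus \bigcup_{H\in\mathcal{A}} H$. The level of a subset $X \subset \mathbb{R}^n$ is the smallest non-negative integer $\ell$ such that $X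 \subset \{x \in \mathbb{R}^n : d(x,W) \le r\}$ for some linear subspace $W$ of dimension $\ell$ and some real $r>0$. Here $\binom{t}{k} = t(t-1)\cdots(t-k+1)/k!$ as a polynomial in $t$. *)

(* Defs.v *)
From HB Require Import structures.
From mathcomp Require Import all_boot all_order all_algebra.
From mathcomp Require Import all_classical all_reals all_analysis.
Set Implicit Arguments. Unset Strict Implicit. Unset Printing Implicit Defensive.
Import Order.TTheory GRing.Theory Num.Theory numFieldNormedType.Exports.
Local Open Scope classical_set_scope.
Local Open Scope ring_scope.

Section Arr.
Variables (R : realType) (n : nat).
Local Notation V := 'rV[R]_n.

Definition coxeter_deformation (a : 'I_n -> 'I_n -> seq R) : set (set V) :=
  [set H | exists i j c, i != j /\ c \in a i j /\
           H = [set x : V | x ord0 i - x ord0 j = c]].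

(* Intersection poset L(A): all nonempty intersections of subfamilies of A
   (the empty subfamily gives R^n). Ordered by reverse inclusion. *)
Definition intersection_poset (A : set (set V)) : set (set V) :=
  [set X | exists F : set (set V), F `<=` A /\ X = \bigcap_(H in F) H
           /\ X !=set0].

Definition is_affine_of_dim (X : set V) (l : nat) : Prop :=
  exists (p : V) (B : 'M[R]_(l, n)), row_free B /\
    X = [set p + u *m B | u in [set: 'rV[R]_l]].
Definition affdim (X : set V) : nat := xget 0%N [set l | is_affine_of_dim X l].

(* Moebius function mu(0^, X) of L, 0^ = R^n, defined by the usual recursion
   mu(0^,0^) = 1, mu(0^,X) = - sum_{0^ <= Y < X} mu(0^,Y).  In reverse
   inclusion order, 0^ <= Y < X means X is a proper subset of Y.  The
   recursion is structural on a fuel argument; chains in L have at most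
   n+1 elements (affine dimension strictly drops), so fuel n.+1 suffices. *)
Fixpoint mobius_fuel (L : set (set V)) (fuel : nat) (X : set V) : int :=
  match fuel with
  | 0%N => 0
  | f.+1 => if `[< X = setT >] then 1
            else - \sum_(Y \in [set Y | L Y /\ X `<` Y]) mobius_fuel L f Y
  end.
Definition mobius0 (L : set (set V)) (X : set V) : int := mobius_fuel L n.+1 X.

Definition arr_char_poly (A : set (set V)) : {poly R} :=
  let L := intersection_poset A in
  \sum_(X \in L) (((mobius0 L X)%:~R : R) *: 'X^(affdim X)).

Definition regions (A : set (set V)) : set (set V) :=
  let C := ~` (\bigcup_(H in A) H) in
  [set Rg | exists x, C x /\ Rg = connected_component C x].

Definition edist (x y : V) : R := Num.sqrt (\sum_(j < n) (x ord0 j - y ord0 j) ^+ 2).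

Definition within_level (X : set V) (l : nat) : Prop :=
  exists (B : 'M[R]_(l, n)) (r : R), row_free B /\ 0 < r /\
    X `<=` [set x | exists u : 'rV[R]_l, edist x (u *m B) <= r].
Definition has_level (X : set V) (l : nat) : Prop :=
  within_level X l /\ forall m, within_level X m -> (l <= m)%N.

Definition num_regions_level (A : set (set V)) (k : nat) : nat :=
  (\sum_(Rg \in [set Rg | regions A Rg /\ has_level Rg k]) 1)%N.

End Arr.

Definition binom_poly (R : fieldType) (k : nat) : {poly R} :=
  (k`!%:R)^-1 *: \prod_(i < k) ('X - (i%:R)%:P).

(* Main.v *)
(* Fix a direction d in {0..q-1}^n and call d a recession direction of a region if
   moving along d never leaves it.  For a relatively open cell P cut out by equations and
   strict inequalities x_i - x_j = c, x_i - x_j < c, let w(P) = (-1)^(dim P) if P is nonempty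
   and recedes along d, and w(P) = 0 otherwise.  Cutting P by a hyperplane H of this type
   satisfies w(P, H<) + w(P, H>) = w(P) - w(P, H=), so iterating over the arrangement turns
   the number of regions receding along d into an alternating sum over subfamilies of
   hyperplanes.  Summing over all d and using Whitney's formula for the characteristic
   polynomial gives, for every deformation,
     chi(-q) = (-1)^n * sum over regions of #{d in {0..q-1}^n recession direction}.
   When every pair i, j carries a hyperplane, the inequalities defining a region order the
   coordinates into a total preorder with k classes, where k is the level of the region (the
   dimension of the span of its recession cone); the recession directions are then the weakly
   increasing sequences of length k, of which there are C(q+k-1, k) = (-1)^k C(-q, k). *)

Require Import Defs.
From HB Require Import structures.
From mathcomp Require Import all_boot all_order all_algebra.
From mathcomp Require Import all_classical all_reals all_analysis.
From mathcomp Require Import ring lra zify.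
Set Implicit Arguments. Unset Strict Implicit. Unset Printing Implicit Defensive.
Import Order.TTheory GRing.Theory Num.Theory numFieldNormedType.Exports.
Local Open Scope classical_set_scope.
Local Open Scope ring_scope.

(** * Monotone functions and graph contraction *)

(** Each value of [f] is replaced by its rank, the number of values of [f] below it. Ranks are
    injective on the image of [f], so by counting they fill the whole of ['I_#|I|]. *)
Lemma compress_ord (T : finType) (m : nat) (f : T -> 'I_m) :
  exists g : T -> 'I_#|f @: [set: T]%SET|,
    (forall i j, (g i <= g j)%N = (f i <= f j)%N) /\ (forall a, exists i, g i = a).
Proof.
set I := f @: _; pose L b := [set a in I | (a < b)%N]%SET.
have inI i : f i \in I by apply/imsetP; exists i.
have Lsub b c : (b <= c)%N -> L b \subset L c.
  by move=> le; apply/fintype.subsetP => a; rewrite !inE => /andP[-> /leq_trans]; apply.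
have Llt (b c : 'I_m) : b \in I -> (b < c)%N -> (#|L b| < #|L c|)%N.
  move=> bI lt; apply: proper_card; rewrite properE Lsub ?(ltnW lt)//=.
  by apply/negP => /fintype.subsetP/(_ b); rewrite !inE bI lt ltnn => /(_ isT).
have Lk (b : 'I_m) : b \in I -> (#|L b| < #|I|)%N.
  move=> bI; apply: proper_card; rewrite properE; apply/andP; split.
    by apply/fintype.subsetP => a; rewrite !inE => /andP[].
  by apply/negP => /fintype.subsetP/(_ b); rewrite !inE bI ltnn => /(_ isT).
have LE (b c : 'I_m) : b \in I -> c \in I -> (#|L b| <= #|L c|)%N = (b <= c)%N.
  move=> bI cI; case: (leqP b c) => le /=; first exact/subset_leq_card/Lsub.
  by apply/negbTE; rewrite -ltnNge; apply: Llt.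
exists (fun i => Ordinal (Lk _ (inI i))); split=> [i j|a]; first by rewrite /= LE.
pose rk (b : 'I_m) := insubd a #|L b|.
have rkE b : b \in I -> val (rk b) = #|L b| by move=> bI; rewrite val_insubd Lk.
have /card_in_imset cI : {in I &, injective rk}.
  move=> b c bI cI /(congr1 val); rewrite !rkE // => /eqP.
  by rewrite eqn_leq !LE // -eqn_leq => /eqP/val_inj.
have : a \in rk @: I.
  have /eqP -> : rk @: I == [set: 'I_#|I|]%SET.
    by rewrite eqEcard finset.subsetT cI cardsT card_ord leqnn.
  by rewrite inE.
case/imsetP => b bI ->; have /imsetP[i _ bE] := bI.
by exists i; apply: val_inj; rewrite rkE //= bE.
Qed.

(** Such a [d] is constant on the fibres of [g], so it amounts to a weakly increasing [k]-tuple with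
    entries in ['I_q.+1]. *)
Lemma card_monotone_factor (T : finType) (k q : nat) (g : T -> 'I_k) :
  (forall a, exists i, g i = a) ->
  #|[set d : {ffun T -> 'I_q.+1} |
      [forall i, forall j, (g i <= g j)%N ==> (d i <= d j)%N]]%SET| = 'C(k + q, k).
Proof.
move=> gsurj; rewrite -card_sorted_tuples.
pose F (t : k.-tuple 'I_q.+1) := [ffun i => tnth t (g i)].
have Finj : injective F.
  move=> t u /ffunP E; apply: eq_from_tnth => a.
  by have [i <-] := gsurj a; have := E i; rewrite !ffunE.
rewrite -(card_imset _ Finj); apply: eq_card => d; rewrite inE.
apply/idP/imsetP => [/forallP mon|[t]].
  have mon' i j : (g i <= g j)%N -> (d i <= d j)%N.
    by move=> le; have /forallP/(_ j)/implyP := mon i; apply.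
  have [h hg] := @choice _ _ (fun a i => g i = a) gsurj.
  exists [tuple d (h a) | a < k]; last first.
    apply/ffunP => i; rewrite ffunE tnth_mktuple.
    by apply: val_inj; apply/eqP; rewrite eqn_leq !mon' // hg.
  rewrite inE -map_comp (sorted_map).
  have : sorted (relpre (fun a => d (h a)) (relpre val leq)) (enum 'I_k).
    apply: (@sub_sorted _ (relpre val leq)).
      by move=> a b /= le; apply: mon'; rewrite !hg.
    by rewrite -sorted_map val_enum_ord iota_sorted.
  by [].
rewrite inE => st ->; apply/forallP => i; apply/forallP => j; apply/implyP => le.
rewrite !ffunE !(tnth_nth ord0) -!(nth_map _ 0%N val) ?size_tuple //.
by apply: (sorted_leq_nth leq_trans leqnn 0%N st); rewrite ?inE ?size_map ?size_tuple.
Qed.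

Lemma card_factor (T : finType) (k q : nat) (g : T -> 'I_k) :
  (forall a, exists i, g i = a) ->
  #|[set d : {ffun T -> 'I_q} |
      [forall i, forall j, (g i == g j) ==> (d i == d j)]]%SET| = (q ^ k)%N.
Proof.
move=> gsurj.
pose F (t : {ffun 'I_k -> 'I_q}) := [ffun i => t (g i)].
have Finj : injective F.
  move=> t u /ffunP E; apply/ffunP => a.
  by have [i <-] := gsurj a; have := E i; rewrite !ffunE.
have <- : #|{ffun 'I_k -> 'I_q}| = (q ^ k)%N by rewrite card_ffun !card_ord.
rewrite -(card_imset _ Finj); apply: eq_card => d; rewrite inE.
apply/idP/imsetP => [/forallP eqd|[t _ ->]].
  have [h hg] := @choice _ _ (fun a i => g i = a) gsurj.
  exists [ffun a => d (h a)] => //; apply/ffunP => i; rewrite !ffunE.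
  by have /forallP/(_ (h (g i)))/implyP := eqd i; rewrite hg => /(_ (eqxx _))/eqP.
by apply/forallP => i; apply/forallP => j; apply/implyP => /eqP; rewrite !ffunE => ->.
Qed.

Section Constraints.
Variables (R : realType) (n : nat).
Local Notation V := 'rV[R]_n.

Definition constraint : Type := 'I_n * 'I_n * R.
Definition src (h : constraint) : 'I_n := h.1.1.
Definition tgt (h : constraint) : 'I_n := h.1.2.

Implicit Types (h : constraint) (B S : seq constraint).

(* Union-find: the image of [contract B] indexes the connected components of the graph
   whose edges are the pairs [(src h, tgt h)] for [h] in [B]. *)
Fixpoint contract (B : seq constraint) (k : 'I_n) : 'I_n :=
  if B is h :: B' then
    if contract B' k == contract B' (tgt h) then contract B' (src h) else contract B' k
  else k.

(** The number of connected components; by [affdim_cell] it is the dimension of the flat cut out by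
    [B] when that flat is nonempty. *)
Definition dimB B : nat := #|contract B @: [set: 'I_n]%SET|.

Definition parallel (T : eqType) (d : 'I_n -> T) B : bool :=
  all (fun h => d (src h) == d (tgt h)) B.

Lemma parallelP (T : eqType) (d : 'I_n -> T) B :
  reflect (forall k l, contract B k = contract B l -> d k = d l) (parallel d B).
Proof.
apply: (iffP idP); elim: B => [|h B IH] /=.
- by move=> _ k l ->.
- case/andP=> /eqP dh /IH {}IH k l.
  case: eqP => [/IH ek|_]; case: eqP => [/IH el|_] => E; last exact: IH.
  + by rewrite ek el.
  + by rewrite ek -dh (IH _ _ E).
  + by rewrite el -dh (IH _ _ E).
- by [].
- move=> H; apply/andP; split; last first.
    by apply: IH => k l E; apply: H; rewrite E.
  by apply/eqP; apply: H; rewrite eqxx; case: ifP.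
Qed.

(** A new edge either stays inside a component or merges two, and then exactly the representative
    [contract B (tgt h)] leaves the image. *)
Lemma dimB_cons h B :
  dimB B = (dimB (h :: B) + (contract B (src h) != contract B (tgt h)))%N.
Proof.
rewrite /dimB /=; set f := contract B.
have [E|ne] := eqVneq (f (src h)) (f (tgt h)).
  rewrite addn0; congr #|pred_of_set _|; apply: eq_imset => k.
  by case: eqP => // ->.
rewrite (cardsD1 (f (tgt h))) addnC imset_f ?inE //; congr (_ + _)%N.
apply: eq_card => a; rewrite !inE; apply/andP/imsetP => [[ane /imsetP[k _ aE]]|[k _ ->]].
  by exists k; [rewrite inE|move: ane; rewrite aE => /negbTE ->].
by case: ifPn => // ?; split; rewrite ?imset_f ?inE //.
Qed.

Lemma contract_factor B : exists g : 'I_n -> 'I_(dimB B),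
  (forall i j, (g i == g j) = (contract B i == contract B j)) /\
  (forall a, exists i, g i = a).
Proof.
have [g [gle gs]] := compress_ord (contract B); exists g; split=> // i j.
by rewrite -!val_eqE /= !eqn_leq !gle.
Qed.

Lemma card_parallel (q : nat) B :
  #|[set d : {ffun 'I_n -> 'I_q} | parallel d B]%SET| = (q ^ dimB B)%N.
Proof.
have [g [geq gs]] := contract_factor B.
rewrite -(card_factor q gs); apply: eq_card => d; rewrite !inE.
apply/parallelP/forallP => [H i|H k l E].
  by apply/forallP => j; apply/implyP; rewrite geq => /eqP/H->.
by have /forallP/(_ l)/implyP := H k; rewrite geq E eqxx => /(_ isT)/eqP.
Qed.

End Constraints.

(** * Cells and the valuation *)

Section Cells.
Variables (R : realType) (n : nat).
Local Notation V := 'rV[R]_n.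
Local Notation constraint := (constraint R n).
Implicit Types (h : constraint) (B S : seq constraint).

Definition gap (x : V) h : R := x ord0 (src h) - x ord0 (tgt h).
Definition flip h : constraint := (tgt h, src h, - h.2).

Definition cell B S : set V :=
  [set x | all (fun h => gap x h == h.2) B && all (fun h => gap x h < h.2) S].

Lemma gap_line (x y : V) (t : R) h : gap (x + t *: y) h = gap x h + t * gap y h.
Proof. by rewrite /gap !mxE; lra. Qed.

Lemma gap_flip (x : V) h : gap x (flip h) = - gap x h.
Proof. by rewrite /gap /= opprB. Qed.

Lemma gap_factor (x : V) B h :
  all (fun h => gap x h == 0) B -> contract B (src h) = contract B (tgt h) -> gap x h = 0.
Proof.
move=> xB; have /parallelP xc : parallel (x ord0) B.
  by apply: sub_all xB => h'; rewrite subr_eq0.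
by move/xc => e; rewrite /gap e subrr.
Qed.

Lemma gapB_eq0 (x y : V) B S : cell B S x -> cell B S y ->
  all (fun h => gap (y - x) h == 0) B.
Proof.
case/andP => /allP xB _ /andP[/allP yB _]; apply/allP => h hB.
have := xB h hB; have := yB h hB; rewrite /gap !mxE => /eqP <- /eqP; lra.
Qed.

Lemma cell_segment (x y : V) (t : R) B S : 0 <= t <= 1 ->
  cell B S x -> cell B S y -> cell B S (x + t *: (y - x)).
Proof.
case/andP => t0 t1 /andP[/allP xB /allP xS] /andP[/allP yB /allP yS].
have E h : gap (x + t *: (y - x)) h = (1 - t) * gap x h + t * gap y h.
  by rewrite gap_line /gap !mxE; lra.
apply/andP; split; apply/allP => h hh.
  by rewrite E (eqP (xB h hh)) (eqP (yB h hh)); apply/eqP; lra.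
rewrite E; have := xS h hh; have := yS h hh => yh xh.
(* For [t < 1] strictness comes from the share [1 - t] of [x]; at [t = 1] that share vanishes and
   the point is [y]. *)
have [t1'|t1'] := ltrP t 1; last by have -> : t = 1; lra.
have : 0 < (1 - t) * (h.2 - gap x h) by apply: mulr_gt0; lra.
have : 0 <= t * (h.2 - gap y h) by apply: mulr_ge0; lra.
lra.
Qed.

Lemma cell_ray (x y : V) (t : R) B S : 0 <= t -> cell B S x ->
  all (fun h => gap y h == 0) B -> all (fun h => gap y h <= 0) S ->
  cell B S (x + t *: y).
Proof.
move=> t0 /andP[/allP xB /allP xS] /allP yB /allP yS.
apply/andP; split; apply/allP => h hh; rewrite gap_line.
  by rewrite (eqP (yB h hh)) mulr0 addr0 xB.
by have := xS h hh; have := yS h hh; nra.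
Qed.

Lemma cell_open (x y : V) B S : cell B S x -> all (fun h => gap y h == 0) B ->
  exists2 e : R, 0 < e & forall t, `|t| <= e -> cell B S (x + t *: y).
Proof.
move=> /andP[/allP xB xS] /allP yB.
suff [e e0 He] : exists2 e : R, 0 < e &
    forall t, `|t| <= e -> all (fun h => gap (x + t *: y) h < h.2) S.
  exists e => // t te; apply/andP; split; last exact: He.
  by apply/allP => h hh; rewrite gap_line (eqP (yB h hh)) mulr0 addr0 xB.
elim: S xS => [_|h S IH /= /andP[xh /IH[e e0 He]]]; first by exists 1.
(* The [+ 1] keeps the denominator positive when [gap y h = 0] and leaves a slack of [e'], which
   makes the final inequality strict. *)
pose e' := (h.2 - gap x h) / (`|gap y h| + 1).
have y0 : 0 < `|gap y h| + 1 by have := normr_ge0 (gap y h); lra.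
have e'0 : 0 < e' by apply: divr_gt0 => //; lra.
exists (Num.min e e'); first by rewrite lt_min e0.
move=> t; rewrite le_min => /andP[te te']; rewrite He // andbT gap_line.
have : t * gap y h <= e' * `|gap y h|.
  by apply: le_trans (ler_norm _) _; rewrite normrM ler_wpM2r.
have : e' * (`|gap y h| + 1) = h.2 - gap x h by rewrite /e' divfK ?gt_eqF.
lra.
Qed.

Lemma below_flip (x : V) h : (gap x (flip h) < (flip h).2) = (h.2 < gap x h).
Proof. by rewrite gap_flip ltrN2. Qed.

Definition rowd (q : nat) (d : 'I_n -> 'I_q) : V := \row_k (d k)%:R.

Lemma gap_rowd_eq0 (q : nat) (d : 'I_n -> 'I_q) h :
  (gap (rowd d) h == 0) = (d (src h) == d (tgt h)).
Proof. by rewrite /gap !mxE subr_eq0 eqr_nat. Qed.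

Lemma gap_rowd_le0 (q : nat) (d : 'I_n -> 'I_q) h :
  (gap (rowd d) h <= 0) = (d (src h) <= d (tgt h))%N.
Proof. by rewrite /gap !mxE subr_le0 ler_nat. Qed.

Definition recession (q : nat) (d : 'I_n -> 'I_q) B S : bool :=
  parallel d B && all (fun h => (d (src h) <= d (tgt h))%N) S.

Lemma cell_rowd (q : nat) (d : 'I_n -> 'I_q) (x : V) (t : R) B S :
  recession d B S -> 0 <= t -> cell B S x -> cell B S (x + t *: rowd d).
Proof.
move=> /andP[dB dS] t0 xc; apply: cell_ray => //.
  by under eq_all do rewrite gap_rowd_eq0.
by under eq_all do rewrite gap_rowd_le0.
Qed.

Lemma cell_cons_far (q : nat) (d : 'I_n -> 'I_q) h B S :
  recession d B S -> (d (src h) < d (tgt h))%N ->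
  cell B S !=set0 -> cell B (h :: S) !=set0.
Proof.
(* Each unit of time along [d] lowers [gap _ h] by at least 1, so this [t] brings it below [h.2]. *)
move=> rec lt [x xc]; pose t := `|gap x h - h.2| + 1.
have t0 : 0 <= t by have := normr_ge0 (gap x h - h.2); rewrite /t; lra.
exists (x + t *: rowd d); have /andP[cB cS] := cell_rowd rec t0 xc.
apply/and3P; split=> //; rewrite gap_line.
have : gap (rowd d) h <= -1.
  rewrite /gap !mxE; have : ((d (src h))%:R + 1 <= (d (tgt h))%:R :> R).
    by rewrite natr1 ler_nat.
  lra.
have := ler_norm (gap x h - h.2); move: t0; rewrite /t; nra.
Qed.

(* The sign is the compactly supported Euler characteristic of the relatively open cell,
   which is what makes [weight d] a valuation. *)
Definition weight (q : nat) (d : 'I_n -> 'I_q) B S : R :=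
  (-1) ^+ dimB B *+ (`[< cell B S !=set0 >] && recession d B S).

(** If [d] separates the two indices of [h], only one open side can recede, and it is nonempty
    whenever the cell is. Otherwise either [gap _ h] is constant on the cell, which then lies in a
    single piece of unchanged dimension, or [h] lowers the dimension by one and the piece on the
    hyperplane is nonempty exactly when both sides are. *)
Lemma weight_split (q : nat) (d : 'I_n -> 'I_q) h B S :
  weight d B (h :: S) + weight d B (flip h :: S) = weight d B S - weight d (h :: B) S.
Proof.
have subl : cell B (h :: S) !=set0 -> cell B S !=set0.
  by case=> x /and3P[xB _ xS]; exists x; apply/andP.
have subr : cell B (flip h :: S) !=set0 -> cell B S !=set0.
  by case=> x /and3P[xB _ xS]; exists x; apply/andP.
have sube : cell (h :: B) S !=set0 -> cell B S !=set0.
  by case=> x /andP[/andP[_ xB] xS]; exists x; apply/andP.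
have cover : cell B S !=set0 ->
    cell B (h :: S) !=set0 \/ cell B (flip h :: S) !=set0 \/ cell (h :: B) S !=set0.
  case=> x /andP[xB xS]; case: (ltgtP (gap x h) h.2) => xh.
  - by left; exists x; apply/and3P.
  - by right; left; exists x; apply/and3P; rewrite below_flip.
  - by right; right; exists x; apply/andP; rewrite /= xh eqxx xB.
rewrite /weight; have [rec|nrec] := boolP (recession d B S); last first.
  have n1 h' : recession d B (h' :: S) = false.
    by apply: contraNF nrec => /and3P[dB _ dS]; apply/andP.
  have n2 : recession d (h :: B) S = false.
    by apply: contraNF nrec => /andP[/andP[_ dB] dS]; apply/andP.
  by rewrite !n1 n2 !andbF !mulr0n; lra.
have [dB dS] := andP rec; rewrite /recession /= dB dS !andbT.
case: ltngtP => dh.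
- have far := cell_cons_far rec dh.
  rewrite -val_eqE /= (ltn_eqF dh) !andbF /= !mulr0n addr0 subr0 andbT.
  by congr (_ *+ nat_of_bool _); apply: asbool_equiv_eq; split.
- have far : cell B S !=set0 -> cell B (flip h :: S) !=set0 by apply: cell_cons_far rec _.
  rewrite -val_eqE /= (gtn_eqF dh) !andbF /= !mulr0n add0r subr0 andbT.
  by congr (_ *+ nat_of_bool _); apply: asbool_equiv_eq; split.
rewrite -val_eqE /= dh eqxx !andbT (dimB_cons h B).
have [ce|cne] := eqVneq (contract B (src h)) (contract B (tgt h)).
  have const x y : cell B S x -> cell B S y -> gap x h = gap y h.
    move=> xc yc; have := gap_factor (gapB_eq0 xc yc) ce.
    by rewrite /gap !mxE; lra.
  have nlr : ~ (cell B (h :: S) !=set0 /\ cell B (flip h :: S) !=set0).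
    case=> -[x /and3P[xB xh xS]] [y /and3P[yB]]; rewrite below_flip => yh yS.
    by have : gap x h = gap y h by [apply: const; apply/andP]; lra.
  have nle : ~ (cell B (h :: S) !=set0 /\ cell (h :: B) S !=set0).
    case=> -[x /and3P[xB xh xS]] [y /andP[/andP[/eqP yh yB] yS]].
    by have : gap x h = gap y h by [apply: const; apply/andP]; lra.
  have nre : ~ (cell B (flip h :: S) !=set0 /\ cell (h :: B) S !=set0).
    case=> -[x /and3P[xB xh xS]] [y /andP[/andP[/eqP yh yB] yS]]; rewrite below_flip in xh.
    by have : gap x h = gap y h by [apply: const; apply/andP]; lra.
  rewrite addn0; set s := _ ^+ _.
  case: (asboolP (cell B (h :: S) !=set0)) => c1; case: (asboolP (cell B (flip h :: S) !=set0)) => c2;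
  case: (asboolP (cell (h :: B) S !=set0)) => c3; case: (asboolP (cell B S !=set0)) => c4;
  rewrite /= ?mulr1n ?mulr0n; first [by lra | by exfalso; tauto].
have eb : cell (h :: B) S !=set0 -> cell B (h :: S) !=set0 /\ cell B (flip h :: S) !=set0.
  case=> x /andP[/andP[/eqP xh xB] xS].
  (* Translating only the component of [src h] preserves [B] and changes [gap _ h] at unit speed, so
     small steps forwards and backwards reach both sides. *)
  pose y : V := \row_k (contract B k == contract B (src h))%:R.
  have yB : all (fun h => gap y h == 0) B.
    have /sub_all : parallel (fun k => contract B k == contract B (src h)) B.
      by apply/parallelP => k l ->.
    by apply=> h' /eqP /= E; rewrite /gap !mxE E subrr.
  have yh : gap y h = 1 by rewrite /gap !mxE eqxx eq_sym (negbTE cne) subr0.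
  have xc : cell B S x by apply/andP.
  have [e e0 He] := cell_open xc yB; split.
    have /andP[cB cS] : cell B S (x + (- e) *: y) by apply: He; rewrite normrN gtr0_norm.
    by exists (x + (- e) *: y); apply/and3P; split=> //; rewrite gap_line xh yh; lra.
  have /andP[cB cS] : cell B S (x + e *: y) by apply: He; rewrite gtr0_norm.
  by exists (x + e *: y); apply/and3P; split=> //; rewrite below_flip gap_line xh yh; lra.
have be : cell B (h :: S) !=set0 -> cell B (flip h :: S) !=set0 -> cell (h :: B) S !=set0.
  case=> x /and3P[xB xh xS] [y /and3P[yB yh yS]]; rewrite below_flip in yh.
  (* The time at which the segment from [x] to [y] crosses the hyperplane. *)
  pose t := (h.2 - gap x h) / (gap y h - gap x h).
  have t01 : 0 <= t <= 1.
    by rewrite /t divr_ge0 ?ler_pdivrMr; lra.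
  have /andP[cB cS] : cell B S (x + t *: (y - x)).
    by apply: cell_segment => //; apply/andP.
  exists (x + t *: (y - x)); apply/andP; split=> //=; rewrite cB andbT gap_line.
  have -> : gap (y - x) h = gap y h - gap x h by rewrite /gap !mxE; lra.
  by rewrite /t divfK; [apply/eqP; lra | apply/eqP; lra].
rewrite addn1 exprS; set s := _ ^+ _.
case: (asboolP (cell B (h :: S) !=set0)) => c1; case: (asboolP (cell B (flip h :: S) !=set0)) => c2;
case: (asboolP (cell (h :: B) S !=set0)) => c3; case: (asboolP (cell B S !=set0)) => c4;
rewrite /= ?mulr1n ?mulr0n; first [by lra | by exfalso; tauto].
Qed.

End Cells.

(** * Counting recession directions; levels *)

Section Recession.
Variables (R : realType) (n : nat).
Local Notation V := 'rV[R]_n.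
Local Notation constraint := (constraint R n).
Implicit Types (h : constraint) (B S : seq constraint).

(* [rcons] rather than [cons] matches the order in which [sum_weight_signs] adds equations. *)
Fixpoint subs (s : seq constraint) : seq (seq constraint) :=
  if s is h :: s' then subs s' ++ [seq rcons B h | B <- subs s'] else [:: [::]].

Fixpoint signs (s : seq constraint) : seq (seq constraint) :=
  if s is h :: s' then [seq h :: Q | Q <- signs s'] ++ [seq flip h :: Q | Q <- signs s']
  else [:: [::]].

(** Cutting by the head of [s] with [weight_split] either imposes a side or moves the constraint
    into [B] at the cost of a sign; hence the induction is general in [B]. *)
Lemma sum_weight_signs (q : nat) (d : 'I_n -> 'I_q) s B S :
  \sum_(S' <- signs s) weight d B (S' ++ S) =
  \sum_(B' <- subs s) (-1) ^+ size B' * weight d (B' ++ B) S.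
Proof.
elim: s B => [|h s IH] B; first by rewrite !big_seq1 mul1r.
rewrite /= !big_cat !big_map /= -big_split /=.
under eq_bigr do rewrite weight_split.
rewrite sumrB !IH; congr (_ + _); rewrite -sumrN; apply: eq_bigr => B' _.
by rewrite cat_rcons size_rcons exprS !mulNr mul1r.
Qed.

Lemma dimB_nil : dimB ([::] : seq constraint) = n.
Proof. by rewrite /dimB imset_id cardsT card_ord. Qed.

(** Without inequalities [d] need only be constant on components, and the sign in [weight] turns the
    count [q ^ dimB B] into a power of [- q]. *)
Lemma sum_weight_parallel (q : nat) B :
  \sum_(d : {ffun 'I_n -> 'I_q}) weight d B [::] =
  (- q%:R) ^+ dimB B *+ `[< cell B [::] !=set0 >].
Proof.
rewrite /weight /recession; case: asboolP => _ /=; last by rewrite big1 // => d _; rewrite mulr0n.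
under eq_bigr do rewrite andbT mulrb.
rewrite -big_mkcond /= sumr_const mulr1n [RHS]exprNn -natrX -(card_parallel q B) mulr_natr.
by congr (_ *+ _); apply: eq_card => d; rewrite inE.
Qed.

(** Both sides equal the sum of [weight d [::] S] over all [d] and all [S] in [signs s]. Whitney's
    formula will identify the left side with the characteristic polynomial at [- q]. *)
Lemma sum_recession (q : nat) s :
  \sum_(B <- subs s) (-1) ^+ size B * ((- q%:R) ^+ dimB B *+ `[< cell B [::] !=set0 >]) =
  \sum_(S <- signs s | `[< cell [::] S !=set0 >])
    (-1) ^+ n * #|[set d : {ffun 'I_n -> 'I_q} | recession d [::] S]%SET|%:R :> R.
Proof.
have E (d : 'I_n -> 'I_q) : \sum_(B <- subs s) (-1) ^+ size B * weight d B [::] =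
    \sum_(S <- signs s) weight d [::] S.
  transitivity (\sum_(S <- signs s) weight d [::] (S ++ [::])).
    by rewrite sum_weight_signs; apply: eq_bigr => B _; rewrite cats0.
  by apply: eq_bigr => S _; rewrite cats0.
under eq_bigr do rewrite -sum_weight_parallel mulr_sumr.
rewrite exchange_big [RHS]big_mkcond /=.
under eq_bigr => d _ do rewrite E.
rewrite exchange_big; apply: eq_bigr => S _.
rewrite /weight dimB_nil; case: asboolP => _ /=; last by rewrite big1 // => d _; rewrite mulr0n.
under eq_bigr do rewrite mulrb.
rewrite -big_mkcond /= sumr_const mulr_natr.
by congr (_ *+ _); apply: eq_card => d; rewrite inE.
Qed.

Definition edge S : rel 'I_n := fun i j => has (fun h => (src h == i) && (tgt h == j)) S.

(** The sets [L i] of vertices not reachable from [i] grow along [connect]; by totality they form a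
    chain, so their cardinalities rank the classes. *)
Lemma total_preorder_factor S :
  (forall i j, i != j -> edge S i j || edge S j i) ->
  exists k (g : 'I_n -> 'I_k),
    (forall i j, (g i <= g j)%N = connect (edge S) i j) /\ (forall a, exists i, g i = a).
Proof.
move=> tot; pose L i := [set j | ~~ connect (edge S) i j]%SET.
have ctot i j : connect (edge S) i j || connect (edge S) j i.
  have [->|/tot/orP[] e] := eqVneq i j; rewrite ?connect0 // (connect1 e) ?orbT //.
have Lsub i j : connect (edge S) i j -> L i \subset L j.
  move=> cij; apply/fintype.subsetP => l; rewrite !inE; apply: contra.
  exact: connect_trans.
have Ln i : (#|L i| < n.+1)%N by rewrite ltnS -[X in (_ <= X)%N](card_ord n) max_card.
have [g [gle gs]] := compress_ord (fun i => Ordinal (Ln i)).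
exists _, g; split=> // i j; rewrite gle /=.
have [cij|ncij] := boolP (connect (edge S) i j); first exact/subset_leq_card/Lsub.
have cji : connect (edge S) j i by have := ctot i j; rewrite (negbTE ncij).
apply/negbTE; rewrite -ltnNge; apply: proper_card; rewrite properE Lsub //=.
by apply/negP => /fintype.subsetP/(_ j); rewrite !inE connect0 ncij => /(_ isT).
Qed.

Lemma edge_recession (q : nat) (d : 'I_n -> 'I_q) S :
  recession d [::] S = [forall i, forall j, connect (edge S) i j ==> (d i <= d j)%N].
Proof.
apply/allP/forallP => [H i|H h hS]; last first.
  have /forallP/(_ (tgt h))/implyP := H (src h); apply; apply: connect1.
  by apply/hasP; exists h; rewrite ?eqxx.
apply/forallP => j; apply/implyP => /connectP[p + ->].
elim: p i => [|l p IH] i //= /andP[/hasP[h hS /andP[/eqP <- /eqP <-]]] /IH.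
exact/leq_trans/H.
Qed.

(** Its row space consists of the vectors that are constant on the fibres of [g]. *)
Definition factor_mx (k : nat) (g : 'I_n -> 'I_k) : 'M[R]_(k, n) := \matrix_(a, i) (g i == a)%:R.

Lemma mul_factor_mx (k : nat) (g : 'I_n -> 'I_k) (u : 'rV[R]_k) i :
  (u *m factor_mx g) ord0 i = u ord0 (g i).
Proof.
rewrite mxE (bigD1 (g i)) //= mxE eqxx mulr1 big1 ?addr0 // => a ane.
by rewrite mxE eq_sym (negbTE ane) mulr0.
Qed.

Lemma row_free_factor_mx (k : nat) (g : 'I_n -> 'I_k) :
  (forall a, exists i, g i = a) -> row_free (factor_mx g).
Proof.
move=> /choice[h hg]; apply/row_freeP; exists (\matrix_(i, a) (i == h a)%:R).
apply/matrixP => a b; rewrite !mxE (bigD1 (h b)) //= !mxE eqxx mulr1 big1 ?addr0.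
  by rewrite hg eq_sym.
by move=> i ine; rewrite mxE (negbTE ine) mulr0.
Qed.

Lemma edist_coord (x y : V) (r : R) : Defs.edist x y <= r -> forall j, `|x ord0 j - y ord0 j| <= r.
Proof.
move=> le j; apply: le_trans le; rewrite -sqrtr_sqr ler_sqrt; last by apply: sumr_ge0 => l _; exact: sqr_ge0.
by rewrite (bigD1 j) //= lerDl; apply: sumr_ge0 => l _; exact: sqr_ge0.
Qed.

(** Applying [cokermx W] kills the row space of [W] and leaves a bounded affine function of [t >= 0]
    in each coordinate, whose slope must be zero. *)
Lemma bounded_ray_sub (l : nat) (W : 'M[R]_(l, n)) (x y : V) (r : R) :
  (forall t, 0 <= t -> exists u : 'rV_l, Defs.edist (x + t *: y) (u *m W) <= r) -> (y <= W)%MS.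
Proof.
move=> H; rewrite submxE; apply/eqP/rowP => j; rewrite [RHS]mxE.
set K := cokermx W; pose c := \sum_i r * `|K i j|.
have bound t : 0 <= t -> `|(x *m K) ord0 j + t * (y *m K) ord0 j| <= c.
  move=> /H[u /edist_coord le].
  have -> : (x *m K) ord0 j + t * (y *m K) ord0 j = ((x + t *: y - u *m W) *m K) ord0 j.
    by rewrite mulmxBl -[u *m W *m K]mulmxA mulmx_coker mulmx0 subr0 mulmxDl -scalemxAl !mxE.
  rewrite mxE; apply: le_trans (ler_norm_sum _ _ _) _; apply: ler_sum => i _.
  rewrite normrM ler_wpM2r //; have := le i; by rewrite !mxE.
set a := (x *m K) ord0 j in bound; set b := (y *m K) ord0 j in bound *.
have a0 : `|a| <= c by have := bound 0 (lexx _); rewrite mul0r addr0.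
apply/eqP/negP => /negP b0; have bp : 0 < `|b| by rewrite normr_gt0.
have c0 : 0 <= c by apply: le_trans a0.
(* At this time the linear term has absolute value [2 * c + 1], while the bounds allow at most
   [c + c]. *)
have := bound ((2 * c + 1) / `|b|); rewrite divr_ge0 //; last by lra.
move=> /(_ isT) le.
have : `|(2 * c + 1) / `|b| * b| <= c + c.
  apply: le_trans (_ : `|a + (2 * c + 1) / `|b| * b| + `|a| <= _); last exact: lerD.
  by apply: le_trans (ler_normB _ _); rewrite addrAC subrr add0r.
rewrite normrM normrM normfV normr_id divfK ?gt_eqF // ger0_norm; lra.
Qed.

(** The strict inequalities telescope along a path of edges. *)
Lemma edge_bound S i j : connect (edge S) i j ->
  exists C : R, forall x, cell [::] S x -> x ord0 i - x ord0 j <= C.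
Proof.
case/connectP => p + ->; elim: p i => [|l p IH] i /=; first by exists 0 => x _; rewrite subrr.
move=> /andP[/hasP[h hS /andP[/eqP <- /eqP <-]] /IH[C HC]].
exists (h.2 + C) => x xS; have := HC x xS; case/andP: xS => _ /allP/(_ h hS).
rewrite /gap; lra.
Qed.

(** Upper bound: coordinates in one class differ boundedly, so the cell stays near the row space of
    [factor_mx g]. Lower bound: the indicator of each upper set [a <= g i] is a recession direction,
    hence lies in any admissible subspace, and differences of consecutive indicators are the rows of
    [factor_mx g]. *)
Lemma level_cell (k : nat) (g : 'I_n -> 'I_k) S :
  (forall i j, (g i <= g j)%N = connect (edge S) i j) -> (forall a, exists i, g i = a) ->
  cell [::] S !=set0 -> has_level (cell [::] S) k.
Proof.
move=> gle gs [x0 x0S]; split.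
  have [h hg] := choice gs.
  have bnd i : exists C : R, forall x, cell [::] S x -> `|x ord0 i - x ord0 (h (g i))| <= C.
    have [C1 H1] : exists C, forall x, cell [::] S x -> x ord0 i - x ord0 (h (g i)) <= C.
      by apply: edge_bound; rewrite -gle hg.
    have [C2 H2] : exists C, forall x, cell [::] S x -> x ord0 (h (g i)) - x ord0 i <= C.
      by apply: edge_bound; rewrite -gle hg.
    exists (`|C1| + `|C2|) => x xS; have := H1 x xS; have := H2 x xS; rewrite ler_norml.
    have := ler_norm C1; have := ler_norm C2; have := normr_ge0 C1; have := normr_ge0 C2; lra.
  have {bnd}[C HC] := choice bnd.
  (* The [+ 1] makes the radius positive even if every [C i] is zero. *)
  exists (factor_mx g), (Num.sqrt (\sum_i C i ^+ 2) + 1).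
  split; first exact: row_free_factor_mx.
  have s0 := sqrtr_ge0 (\sum_i C i ^+ 2); split; first lra.
  move=> x xS /=; exists (\row_a x ord0 (h a)).
  suff : Defs.edist x (\row_a x ord0 (h a) *m factor_mx g) <= Num.sqrt (\sum_i C i ^+ 2) by lra.
  apply: ler_wsqrtr; apply: ler_sum => i _; rewrite mul_factor_mx mxE.
  have := HC i x xS; rewrite ler_norml; nra.
move=> m [W [r [Wfree [r0 sub]]]].
have mono (a : nat) : ((\row_i (a <= g i)%N%:R : V) <= W)%MS.
  apply: (@bounded_ray_sub _ _ x0 _ r) => t t0.
  apply: sub; apply: cell_ray => //; apply/allP => h hS.
  rewrite /gap !mxE subr_le0 ler_nat.
  have : (g (src h) <= g (tgt h))%N.
    by rewrite gle connect1 //; apply/hasP; exists h; rewrite ?eqxx.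
  by move=> le1; case: (leqP a (g (src h))) => //= le2; rewrite (leq_trans le2 le1).
suff /mxrankS : (factor_mx g <= W)%MS by rewrite (eqP Wfree) (eqP (row_free_factor_mx gs)).
apply/row_subP => a.
have -> : row a (factor_mx g) = \row_i (a <= g i)%N%:R - \row_i (a < g i)%N%:R.
  apply/rowP => i; rewrite !mxE -val_eqE /=.
  by case: (ltngtP a (g i)) => /=; rewrite ?subrr ?subr0.
by apply: addmx_sub; rewrite ?eqmx_opp; apply: mono.
Qed.

Lemma level_recession S :
  (forall i j, i != j -> edge S i j || edge S j i) -> cell [::] S !=set0 ->
  exists k, [/\ has_level (cell [::] S) k, (k <= n)%N &
    forall q, #|[set d : {ffun 'I_n -> 'I_q.+1} | recession d [::] S]%SET| = 'C(k + q, k)].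
Proof.
move=> tot ne; have [k [g [gle gs]]] := total_preorder_factor tot.
exists k; split; first exact: level_cell gle gs ne.
  have [h hg] := choice gs.
  by rewrite -{1}(card_ord k) -(card_ord n); apply: (leq_card h); apply: can_inj hg.
move=> q; rewrite -(card_monotone_factor q gs); apply: eq_card => d; rewrite !inE.
rewrite edge_recession; apply: eq_forallb => i; apply: eq_forallb => j.
by rewrite gle.
Qed.

End Recession.

(** * Whitney's formula *)

Section IntersectionPoset.
Variables (R : realType) (n : nat).
Local Notation V := 'rV[R]_n.
Local Notation constraint := (constraint R n).
Implicit Types (h : constraint) (B S : seq constraint).

Definition hyperplane h : set V := [set x | gap x h = h.2].

Lemma cell_bigcap B : cell B [::] = \bigcap_(h in [set` B]) hyperplane h.
Proof.
apply/seteqP; split=> x; rewrite /cell /= andbT.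
  by move=> /allP xB h /= hB; apply/eqP/xB.
by move=> xB; apply/allP => h hB; apply/eqP/xB.
Qed.

Lemma cell_nil : cell [::] [::] = [set: V].
Proof. by apply/seteqP; split. Qed.

(** Used in both directions, this makes the [xget] in [affdim] unambiguous: directions are
    differences of points, so one direction space lies in the other. *)
Lemma affine_dim_le (X : set V) (k l : nat) :
  is_affine_of_dim X k -> is_affine_of_dim X l -> (k <= l)%N.
Proof.
move=> [p [B [Bfree XB]]] [p' [B' [Bfree' XB']]].
suff /mxrankS : (B <= B')%MS by rewrite (eqP Bfree) (eqP Bfree').
have mem (u : 'rV_k) : exists v : 'rV_l, p' + v *m B' = p + u *m B.
  have : X (p + u *m B) by rewrite XB; exists u.
  by rewrite {1}XB' => -[v _ E]; exists v.
apply/row_subP => a; have [v0 e0] := mem 0; have [v ev] := mem (delta_mx 0 a).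
rewrite rowE; apply/submxP; exists (v - v0); rewrite mulmxBl.
move: e0 ev; rewrite mul0mx addr0 => <- /eqP.
by rewrite -addrA (inj_eq (addrI _)) => /eqP ->; rewrite addrAC subrr add0r.
Qed.

Lemma gap_parallel (x : V) B : all (fun h => gap x h == 0) B = parallel (x ord0) B.
Proof. by apply: eq_all => h; rewrite subr_eq0. Qed.

Lemma affdim_cell B : cell B [::] !=set0 -> affdim (cell B [::]) = dimB B.
Proof.
case=> p pB.
have dimP : is_affine_of_dim (cell B [::]) (dimB B).
  have [g [geq gs]] := contract_factor B.
  exists p, (factor_mx R g); split; first exact: row_free_factor_mx.
  apply/seteqP; split=> [x xB|_ [u _ <-]].
    have [h hg] := choice gs.
    have /parallelP xp : parallel ((x - p) ord0) B.
      by rewrite -gap_parallel; apply: gapB_eq0 xB.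
    exists (\row_a (x - p) ord0 (h a)) => //; apply/rowP => i.
    rewrite mxE mul_factor_mx mxE (xp _ i) ?mxE; first by rewrite addrC subrK.
    by apply/eqP; rewrite -geq hg.
  rewrite -[u *m _]scale1r; apply: cell_ray => //; rewrite gap_parallel.
  by apply/parallelP => k l e; rewrite !mul_factor_mx (eqP (_ : g k == g l)) // geq e.
apply: xget_unique => // l lP; apply/eqP.
by rewrite eqn_leq !(@affine_dim_le (cell B [::])).
Qed.

(** Dimensions are compared by counting 0-1 directions: those parallel to [B] number [2 ^ dimB B],
    and they form a proper subset of those parallel to [B']. *)
Lemma cell_proper_dim B B' : cell B [::] !=set0 -> cell B [::] `<` cell B' [::] ->
  (dimB B < dimB B')%N.
Proof.
case=> p pB [sub nsub].
have [x [xB' xNB]] : exists x, cell B' [::] x /\ ~ cell B [::] x.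
  apply: contrapT => H; apply: nsub => x xB'.
  by apply: contrapT => xNB; apply: H; exists x.
suff /proper_card : [set d : {ffun 'I_n -> 'I_2} | parallel d B]%SET
    \proper [set d : {ffun 'I_n -> 'I_2} | parallel d B']%SET.
  by rewrite !card_parallel ltn_exp2l.
have pB' := sub p pB; rewrite properE; apply/andP; split.
  apply/fintype.subsetP => d; rewrite !inE => dB.
  have /sub dB' : cell B [::] (p + 1 *: rowd R d).
    by apply: cell_rowd => //; rewrite /recession dB.
  have := gapB_eq0 pB' dB'; rewrite scale1r addrAC subrr add0r.
  by under eq_all do rewrite gap_rowd_eq0.
have [h hB ne] : exists2 h, h \in B & gap (x - p) h != 0.
  apply/allPn; apply/negP => H; apply: xNB.
  rewrite (_ : x = p + 1 *: (x - p)); last by rewrite scale1r addrC subrK.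
  by apply: cell_ray => //.
(* Being a function of the coordinates of [x - p], [d] is parallel to [B']; yet it separates the two
   indices of [h], where [x - p] differs. *)
pose d := [ffun k => if (x - p) ord0 k == (x - p) ord0 (src h) then ord0 else ord_max] : {ffun 'I_n -> 'I_2}.
apply/negP => /fintype.subsetP/(_ d); rewrite !inE.
have -> : parallel d B'.
  have /parallelP xp : parallel ((x - p) ord0) B' by rewrite -gap_parallel; apply: gapB_eq0 xB'.
  by apply/parallelP => k l /xp e; rewrite !ffunE e.
move=> /(_ isT)/allP/(_ h hB); rewrite !ffunE eqxx.
by case: ifP => [/eqP e _|_ //]; move: ne; rewrite /gap e subrr eqxx.
Qed.

Section Whitney.
Variable s : seq constraint.
Hypothesis s_proper : forall h, h \in s -> src h != tgt h.

Let A : set (set V) := [set H | exists2 h, h \in s & H = hyperplane h].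
Let L := undup [seq cell B [::] | B <- subs s & `[< cell B [::] !=set0 >]].

Lemma mem_subs B h : B \in subs s -> h \in B -> h \in s.
Proof.
elim: s B => [|h' s' IH] B /=; first by rewrite inE => /eqP ->.
rewrite mem_cat => /orP[/IH H /H|/mapP[B' /IH H ->]]; first by rewrite inE orbC => ->.
by rewrite mem_rcons !inE => /orP[->//|/H ->]; rewrite orbT.
Qed.

Lemma rev_filter_subs (P : pred constraint) : rev [seq h <- s | P h] \in subs s.
Proof.
elim: s => [|h s' IH] //=; rewrite mem_cat; case: ifP => _; last by rewrite IH.
by apply/orP; right; apply/mapP; exists (rev [seq x <- s' | P x]); rewrite ?rev_cons.
Qed.

Lemma intersection_posetE : intersection_poset A = [set` L].
Proof.
apply/seteqP; split=> X /=.
  move=> [F [FA [XF Xne]]]; rewrite mem_undup.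
  pose B := rev [seq h <- s | `[< F (hyperplane h) >]].
  suff XB : X = cell B [::].
    apply/mapP; exists B => //; rewrite mem_filter rev_filter_subs andbT.
    by apply/asboolP; rewrite -XB.
  rewrite XF cell_bigcap; apply/seteqP; split=> x xF.
    by move=> h /=; rewrite mem_rev mem_filter => /andP[/asboolP Fh _]; apply: xF.
  move=> H FH; have [h hs He] := FA H FH; rewrite He; apply: xF.
  by rewrite /= mem_rev mem_filter hs andbT; apply/asboolP; rewrite -He.
rewrite mem_undup => /mapP[B]; rewrite mem_filter => /andP[/asboolP ne Bs] ->.
exists (hyperplane @` [set` B]); split.
  by move=> _ [h hB <-]; exists h => //; apply: mem_subs Bs hB.
by rewrite cell_bigcap bigcap_image -cell_bigcap.
Qed.

(** Toggling one entry that satisfies [p] cancels the subfamilies in pairs; if there is none, only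
    the empty subfamily survives. *)
Lemma sum_subs_all (p : pred constraint) :
  \sum_(B <- subs s) (-1) ^+ size B * (all p B)%:R = (all (predC p) s)%:R :> int.
Proof.
elim: s => [|h s' IH] /=; first by rewrite big_seq1 mul1r.
rewrite big_cat big_map /= IH.
under eq_bigr do rewrite size_rcons all_rcons exprS mulN1r mulNr.
rewrite sumrN; case: (p h) => /=; first by rewrite IH subrr.
by rewrite big1 ?subr0 // => B _; rewrite mulr0.
Qed.

(* By Whitney's theorem this is the Moebius function of the intersection poset. *)
Let whitney (X : set V) : int := \sum_(B <- subs s) (-1) ^+ size B * (cell B [::] == X)%:R.

Lemma cellP B : B \in subs s -> cell B [::] !=set0 -> cell B [::] \in L.
Proof.
move=> Bs ne; rewrite mem_undup; apply/mapP; exists B => //.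
by rewrite mem_filter Bs andbT; apply/asboolP.
Qed.

(** Regroups subfamilies by the flat they cut out. [U] is [int] in [whitney_recursion] and
    [{poly R}] in [whitney_char_poly]. *)
Lemma sum_whitney (U : zmodType) (F : set V -> U) :
  \sum_(X <- L) F X *~ whitney X =
  \sum_(B <- subs s | `[< cell B [::] !=set0 >]) F (cell B [::]) *~ ((-1) ^+ size B).
Proof.
under eq_bigr do rewrite mulrz_sumr.
rewrite exchange_big [RHS]big_mkcond /= big_seq [RHS]big_seq; apply: eq_bigr => B Bs.
case: asboolP => ne.
  rewrite (bigD1_seq (cell B [::])) ?cellP ?undup_uniq //= eqxx mulr1 big1 ?addr0 // => X.
  by rewrite eq_sym => /negbTE ->; rewrite mulr0 mulr0z.
rewrite big_seq big1 // => X; rewrite mem_undup => /mapP[B']; rewrite mem_filter => /andP[/asboolP ne' _] XE.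
by case: eqP => [E|_]; [case: ne; rewrite E XE | rewrite mulr0 mulr0z].
Qed.

Lemma mem_L X : X \in L -> exists B, [/\ B \in subs s, X = cell B [::] & X !=set0].
Proof.
rewrite mem_undup => /mapP[B]; rewrite mem_filter => /andP[/asboolP ne Bs] ->.
by exists B.
Qed.

(** The sum runs over the subfamilies of hyperplanes containing [X], so by [sum_subs_all] it
    vanishes unless no hyperplane contains [X], which for a flat means that [X] is the whole
    space. *)
Lemma whitney_recursion X : X \in L ->
  \sum_(Y <- L | `[< X `<=` Y >]) whitney Y = (X == setT)%:R.
Proof.
move=> /mem_L[B [Bs XB [x0 Xx0]]].
have -> : \sum_(Y <- L | `[< X `<=` Y >]) whitney Y = \sum_(Y <- L) (`[< X `<=` Y >]%:R : int) *~ whitney Y.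
  by rewrite big_mkcond; apply: eq_bigr => Y _; case: ifP; rewrite ?mul0rz // intz.
rewrite sum_whitney big_mkcond /=.
pose p h := `[< X `<=` hyperplane h >].
transitivity (\sum_(B <- subs s) (-1) ^+ size B * (all p B)%:R : int).
  apply: eq_bigr => B' _.
  have -> : `[< X `<=` cell B' [::] >] = all p B'.
    apply/asboolP/allP => [sub h hB|sub x Xx].
      apply/asboolP => x /sub; rewrite cell_bigcap; exact.
    rewrite cell_bigcap => h hB; have /asboolP := sub h hB; exact.
  case: (boolP (all p B')) => [/allP ap|_]; last by rewrite mul0rz mulr0 if_same.
  rewrite asboolT ?intz ?mulr1 //; exists x0; rewrite cell_bigcap => h hB.
  by have /asboolP := ap h hB; exact.
rewrite sum_subs_all; congr (nat_of_bool _)%:R.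
apply/allP/eqP => [np|XT h hs /=].
  rewrite XB; case: B Bs XB => [|h B] Bs XB; first exact: cell_nil.
  have /negP[] := np h (mem_subs Bs (mem_head _ _)).
  by apply/asboolP; rewrite XB cell_bigcap => x; apply; exact: mem_head.
(* This point has gap [h.2 + 1], so it lies off the hyperplane. *)
apply/negP => /asboolP; rewrite XT => /(_ (\row_k ((h.2 + 1) *+ (k == src h))) I).
rewrite /hyperplane /= /gap !mxE eqxx eq_sym (negbTE (s_proper hs)) mulr0n mulr1n; lra.
Qed.

Lemma fsbig_mem_cond (U : nmodType) (F : set V -> U) (P : set V -> Prop) :
  \sum_(X \in [set X | X \in L /\ P X]) F X = \sum_(X <- L | `[< P X >]) F X.
Proof.
have -> : [set X | X \in L /\ P X] = [set` [seq X <- L | `[< P X >]]].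
  apply/seteqP; split=> X /=; rewrite mem_filter; first by case=> -> /asboolP ->.
  by case/andP => /asboolP.
by rewrite -fsbig_seq ?filter_uniq ?undup_uniq // big_filter.
Qed.

(** Both functions obey the same recursion. Each strictly larger flat has larger dimension, which
    pays for the unit of fuel spent; fuel 0 would force [dimB B] above [n]. *)
Lemma mobius_whitney f B : B \in subs s -> cell B [::] !=set0 -> (n < f + dimB B)%N ->
  mobius_fuel [set` L] f (cell B [::]) = whitney (cell B [::]).
Proof.
elim: f B => [|f IH] B Bs ne.
  rewrite add0n ltnNge -{2}(card_ord n) /dimB.
  by rewrite (leq_trans (leq_imset_card _ _)) ?cardsT.
move=> nf /=; set X := cell B [::]; have XL : X \in L := cellP Bs ne.
have := whitney_recursion XL.
have -> : \sum_(Y <- L | `[< X `<=` Y >]) whitney Y =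
    whitney X + \sum_(Y <- L | `[< X `<` Y >]) whitney Y.
  rewrite big_mkcond (bigD1_seq X) ?undup_uniq //= ifT; last by apply/asboolP.
  congr (_ + _); rewrite big_mkcond [RHS]big_mkcond; apply: eq_bigr => Y _.
  rewrite -if_and; congr (if _ then _ else _).
  apply/andP/asboolP => [[/eqP YX /asboolP sub]|[sub nsub]].
    by rewrite properEneq; split=> //; apply/eqP => E; apply: YX; rewrite E.
  by split; [apply/eqP => E; apply: nsub; rewrite E | apply/asboolP].
case: asboolP => [XT|XnT].
  rewrite big1_seq ?addr0 => [->|Y /andP[/asboolP[_ nsub] _]]; first by rewrite XT eqxx.
  by case: nsub; rewrite XT.
have /negbTE -> : X != setT by apply/eqP.
move=> /eqP; rewrite addr_eq0 => /eqP ->; congr (- _).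
rewrite (fsbig_mem_cond _ (fun Y => X `<` Y)) big_seq_cond [RHS]big_seq_cond.
apply: eq_bigr => Y /andP[/mem_L[B' [Bs' YB' ne']] /asboolP]; rewrite YB' => lt.
apply: IH => //; first by rewrite -YB'.
by have := cell_proper_dim ne lt; lia.
Qed.

Lemma whitney_char_poly :
  arr_char_poly A =
  \sum_(B <- subs s | `[< cell B [::] !=set0 >]) (-1) ^+ size B *: 'X^(dimB B) :> {poly R}.
Proof.
rewrite /arr_char_poly intersection_posetE -fsbig_seq ?undup_uniq //.
transitivity (\sum_(X <- L) ('X^(affdim X) : {poly R}) *~ whitney X).
  apply: eq_big_seq => X /mem_L[B [Bs XB ne]].
  rewrite /mobius0 XB mobius_whitney // -?XB //; last by rewrite addSn ltnS leq_addr.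
  by rewrite scaler_int.
rewrite sum_whitney; apply: eq_bigr => B /asboolP ne.
by rewrite affdim_cell // -scaler_int rmorphXn rmorphN rmorph1.
Qed.

End Whitney.

End IntersectionPoset.

(** * Regions as cells *)

Section Components.
Variables (R : realType) (n : nat).
Local Notation V := 'rV[R]_n.
Local Notation constraint := (constraint R n).
Implicit Types (h : constraint) (B S : seq constraint).

Lemma signs_mem s S h : S \in signs s -> h \in s -> (h \in S) || (flip h \in S).
Proof.
elim: s S => [|h' s IH] S //=; rewrite mem_cat => /orP[] /mapP[S' /IH {}IH ->];
  rewrite !inE => /orP[/eqP ->|/IH /orP[] ->]; by rewrite ?eqxx ?orbT.
Qed.

(** A tie goes to [flip h], so [x] lies in the resulting cell only when it is off every
    hyperplane. *)
Definition chamber (x : V) s : seq constraint :=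
  [seq if gap x h < h.2 then h else flip h | h <- s].

Lemma chamber_signs x s : chamber x s \in signs s.
Proof.
elim: s => [|h s IH] //=; rewrite mem_cat; apply/orP.
by case: ifP => _; [left|right]; rewrite map_f.
Qed.

Lemma cell_chamber x s : all (fun h => gap x h != h.2) s -> cell [::] (chamber x s) x.
Proof.
move=> /allP ne; apply/allP => _ /mapP[h hs ->]; case: ifPn => //; rewrite -leNgt => le.
by rewrite below_flip lt_def ne.
Qed.

Lemma signs_chamber x s S : S \in signs s -> cell [::] S x ->
  all (fun h => gap x h != h.2) s /\ S = chamber x s.
Proof.
rewrite /cell /=; elim: s S => [|h s IH] S /=; first by rewrite inE => /eqP.
rewrite mem_cat => /orP[] /mapP[S' /IH {}IH ->] /= /andP[xh /IH[-> <-]].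
  by rewrite lt_eqF // xh.
by move: xh; rewrite below_flip => xh; rewrite gt_eqF // ltNge (ltW xh).
Qed.

(** Since [h] and [flip h] have different sources, sign lists stay distinct even if [s] repeats a
    hyperplane. *)
Lemma signs_uniq s : (forall h, h \in s -> src h != tgt h) -> uniq (signs s).
Proof.
elim: s => [|h s IH] //= sp.
have us : uniq (signs s) by apply: IH => h' hs; apply: sp; rewrite inE hs orbT.
rewrite cat_uniq !map_inj_uniq ?us //= ?andbT; try by move=> ? ? [].
apply/hasPn => _ /mapP[S' _ ->]; apply/negP => /mapP[S _ [E _]].
by have := sp h (mem_head _ _); rewrite -[X in src X]E eqxx.
Qed.

Lemma gap_continuous h : continuous (fun x : V => gap x h).
Proof. move=> x; have c := @coord_continuous R 1 n ord0.
exact: (continuousB (c (src h) x) (c (tgt h) x)). Qed.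

Lemma convex_cell_connected B S : connected (cell B S).
Proof.
have [->|[p pB]] : cell B S = set0 \/ cell B S !=set0.
  by have [->|/set0P] := eqVneq (cell B S) set0; [left|right].
  exact: connected0.
have -> : cell B S = \bigcup_(x in cell B S) ((fun t : R => p + t *: (x - p)) @` `[0, 1]).
  apply/seteqP; split=> x.
    move=> xS; exists x => //; exists 1; first by rewrite /= in_itv /= ler01 lexx.
    by rewrite scale1r addrC subrK.
  move=> [y yS [t]]; rewrite /= in_itv /= => t01 <-; exact: cell_segment.
apply: bigcup_connected.
  exists p => x xS; exists 0; first by rewrite /= in_itv /= ler01 lexx.
  by rewrite scale0r addr0.
move=> x xS; apply: connected_continuous_connected; first exact: segment_connected.
apply: continuous_subspaceT => t; apply: cvgD; first exact: cvg_cst.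
by apply: cvgZr_tmp; exact: cvg_id.
Qed.

Section Regions.
Variable s : seq constraint.
Hypothesis s_proper : forall h, h \in s -> src h != tgt h.

Let A : set (set V) := [set H | exists2 h, h \in s & H = hyperplane h].

Lemma complementP x : reflect ((~` (\bigcup_(H in A) H)) x) (all (fun h => gap x h != h.2) s).
Proof.
apply: (iffP allP) => [ne [_ [h hs ->] xh]|nx h hs].
  by have := ne h hs; rewrite xh eqxx.
by apply/eqP => xh; apply: nx; exists (hyperplane h) => //; exists h.
Qed.

(** The cell is connected and avoids the arrangement, so it lies in the component. Conversely each
    [gap _ h] maps the component onto an interval missing [h.2], so no sign changes on it. *)
Lemma component_chamber x : (~` (\bigcup_(H in A) H)) x ->
  connected_component (~` (\bigcup_(H in A) H)) x = cell [::] (chamber x s).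
Proof.
move=> xC; have xc := cell_chamber (introT (complementP x) xC).
apply/seteqP; split; last first.
  apply: connected_component_max => //; last exact: convex_cell_connected.
  by move=> y /(signs_chamber (chamber_signs x s))[/complementP].
set K := connected_component _ x => y yK.
have xK : K x by apply: connected_component_refl.
have KC : K `<=` ~` (\bigcup_(H in A) H) by apply: connected_component_sub.
suff E : chamber x s = chamber y s by rewrite E; apply: cell_chamber; apply/complementP/KC.
apply/eq_in_map => h hs.
have /connected_intervalP itv : connected ((fun x : V => gap x h) @` K).
  apply: connected_continuous_connected; first exact: component_connected.
  exact/continuous_subspaceT/gap_continuous.
have nc : ~ ((fun x : V => gap x h) @` K) h.2.
  by case=> z /KC/complementP/allP/(_ h hs)/eqP.
have Kx : ((fun x : V => gap x h) @` K) (gap x h) by exists x.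
have Ky : ((fun x : V => gap x h) @` K) (gap y h) by exists y.
case: ltP => xh; case: ltP => yh //; case: nc.
  by apply: (itv _ _ Kx Ky); rewrite (ltW xh).
by apply: (itv _ _ Ky Kx); rewrite (ltW yh).
Qed.

Lemma num_regions_levelE k : num_regions_level A k =
  (\sum_(S <- signs s | `[< cell [::] S !=set0 >] && `[< has_level (cell [::] S) k >]) 1)%N.
Proof.
rewrite /num_regions_level -big_filter; set r := seq.filter _ _.
have inj : {in r &, injective (fun S => cell [::] S)}.
  move=> S S'; rewrite !mem_filter => /andP[/andP[/asboolP[x xS] _] Ss] /andP[_ Ss'] E.
  have [_ ->] := signs_chamber Ss xS; rewrite E in xS.
  by have [_ ->] := signs_chamber Ss' xS.
have -> : [set Rg | regions A Rg /\ has_level Rg k] = [set` [seq cell [::] Q | Q <- r]].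
  apply/seteqP; split=> [_ [[x [xC ->]]]|_ /= /mapP[S + ->]].
    rewrite component_chamber // => lev; apply/mapP; exists (chamber x s) => //.
    rewrite mem_filter chamber_signs andbT; apply/andP; split; apply/asboolP => //.
    by exists x; apply/cell_chamber/complementP.
  rewrite mem_filter => /andP[/andP[/asboolP[x xS] /asboolP lev] Ss]; split=> //.
  have [/complementP xC SE] := signs_chamber Ss xS.
  by exists x; split=> //; rewrite component_chamber // SE.
by rewrite -fsbig_seq ?map_inj_in_uniq ?filter_uniq ?signs_uniq // big_map.
Qed.

End Regions.

End Components.

(** * Evaluation at negative integers and the final count *)

Lemma binom_poly_neg (R : realType) (k q : nat) :
  (binom_poly R k).[- q.+1%:R] = (-1) ^+ k * 'C(k + q, k)%:R.
Proof.
have prodE : \prod_(i < k) (- q.+1%:R - i%:R : R) = (-1) ^+ k * (k`! * 'C(k + q, k))%:R.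
  elim: k => [|k IH]; first by rewrite big_ord0 fact0 bin0 mul1r.
  rewrite big_ord_recr /= IH factS [(k.+1 * _)%N]mulnC -mulnA -mul_bin_diag addSn.
  by rewrite -opprD -natrD addSn [(q + k)%N]addnC mulnCA !natrM exprS; ring.
rewrite /binom_poly hornerZ horner_prod.
under eq_bigr do rewrite !hornerE.
rewrite prodE natrM mulrCA; congr (_ * _); rewrite mulKf // pnatr_eq0 -lt0n; exact: fact_gt0.
Qed.

Lemma poly_eq_at_negatives (R : realType) (p q : {poly R}) :
  (forall m : nat, p.[- m.+1%:R] = q.[- m.+1%:R]) -> p = q.
Proof.
move=> pq; apply/eqP; rewrite -subr_eq0; apply/eqP.
pose N := size (p - q).
apply: (@roots_geq_poly_eq0 _ _ [seq - m.+1%:R | m <- iota 0 N]).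
- by apply/allP => _ /mapP[m _ ->]; rewrite /root !hornerE pq subrr.
- rewrite map_inj_uniq ?iota_uniq // => m m' /oppr_inj/eqP.
  by rewrite eqr_nat => /eqP[].
- by rewrite size_map size_iota.
Qed.

(** The same hyperplane may occur several times, also with its indices exchanged; only the set of
    hyperplanes enters [arr_char_poly] and [regions]. *)
Definition deformation_constraints (R : realType) (n : nat) (a : 'I_n -> 'I_n -> seq R) :
    seq (constraint R n) :=
  [seq (p, c) | p <- [seq p <- enum {: 'I_n * 'I_n} | p.1 != p.2], c <- a p.1 p.2].

Lemma mem_deformation_constraints (R : realType) (n : nat) (a : 'I_n -> 'I_n -> seq R)
    (h : constraint R n) :
  (h \in deformation_constraints a) = (src h != tgt h) && (h.2 \in a (src h) (tgt h)).
Proof.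
apply/allpairsPdep/andP => [[p [c [+ ca ->]]]|[ne ha]].
  by rewrite mem_filter => /andP[].
exists h.1, h.2; split=> //; last by case: h {ne ha}.
by rewrite mem_filter ne mem_enum.
Qed.

Lemma coxeter_deformationE (R : realType) (n : nat) (a : 'I_n -> 'I_n -> seq R) :
  coxeter_deformation a =
  [set H | exists2 h, h \in deformation_constraints a & H = hyperplane h].
Proof.
apply/seteqP; split=> H.
  move=> [i [j [c [ij [ca ->]]]]]; exists ((i, j), c) => //.
  by rewrite mem_deformation_constraints ij.
move=> [h]; rewrite mem_deformation_constraints => /andP[ne ha ->].
by exists (src h), (tgt h), h.2.
Qed.

Theorem theorem1p1 (R : realType) (n : nat) (a : 'I_n -> 'I_n -> seq R) :
  (1 <= n)%N ->
  (forall i j : 'I_n, i != j -> a i j != [::]) ->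
  arr_char_poly (coxeter_deformation a) =
  \sum_(k < n.+1)
     (((-1) ^+ (n - k) * (num_regions_level (coxeter_deformation a) k)%:R : R)
        *: binom_poly R k).
Proof.
move=> _ nondeg; rewrite coxeter_deformationE; set s := deformation_constraints a.
have s_proper h : h \in s -> src h != tgt h.
  by rewrite mem_deformation_constraints => /andP[].
rewrite whitney_char_poly //; apply: poly_eq_at_negatives => q.
rewrite !horner_sum.
transitivity (\sum_(B <- subs s) (-1) ^+ size B * ((- q.+1%:R) ^+ dimB B *+ `[< cell B [::] !=set0 >]) : R).
  rewrite big_mkcond; apply: eq_bigr => B _; case: ifP => _; last by rewrite mulr0n mulr0.
  by rewrite hornerZ hornerXn mulr1n.
rewrite sum_recession -mulr_sumr -natr_sum.
(* The sign [(-1) ^+ k] of the binomial at [- q.+1] combines with [(-1) ^+ (n - k)], so a common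
   [(-1) ^+ n] factors out. *)
transitivity ((-1) ^+ n * (\sum_(k < n.+1)
    num_regions_level [set H | exists2 h, h \in s & H = hyperplane h] k * 'C(k + q, k))%:R : R).
  2: { rewrite natr_sum mulr_sumr; apply: eq_bigr => k _.
       rewrite hornerZ binom_poly_neg natrM -{1}(subnK (leq_ord k)) exprD; ring. }
congr (_ * _%:R).
under [RHS]eq_bigr do rewrite num_regions_levelE // -big_filter big_distrl /= big_filter big_mkcondr.
rewrite exchange_big /= big_seq_cond [RHS]big_seq_cond; apply: eq_bigr => S /andP[Ss /asboolP ne].
(* Non-degeneracy enters here: a hyperplane on the pair gives an edge, oriented by the side that [S]
   chooses. *)
have tot i j : i != j -> edge S i j || edge S j i.
  move=> ij; have [c ca] : exists c, c \in a i j.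
    by case: (a i j) (nondeg i j ij) => // c l _; exists c; rewrite mem_head.
  have hs : ((i, j), c) \in s by rewrite mem_deformation_constraints ij.
  apply/orP; case/orP: (signs_mem Ss hs) => hS; [left|right]; apply/hasP.
    by exists ((i, j), c); rewrite ?eqxx.
  by exists (flip ((i, j), c)); rewrite ?eqxx.
have [k [lev kn cnt]] := level_recession tot ne.
(* A cell has only one level, so among all [l] only [k] contributes. *)
rewrite cnt (bigD1 (Ordinal (kn : (k < n.+1)%N))) //= asboolT // mul1n big1 ?addn0 // => l lk.
rewrite asboolF // => lev'; move: lk; rewrite -val_eqE /= eqn_leq.
by rewrite (lev.2 _ lev'.1) (lev'.2 _ lev.1).
Qed.
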